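(* For every $k \in \mathbb{N}$ one has $$\mathcal{P}_k = \mathcal{M}^q_k \oplus \underline{\mathbf{x}}\,\mathcal{P}_{k-1}.$$ Further, the subspaces $\mathcal{M}^q_k$ and $\underline{\mathbf{x}}\,\mathcal{P}_{k-1}$ of $\mathcal{P}_k$ are orthogonal with respect to the scalar product $\langle\cdot,\cdot\rangle_{k,q}$.
   Context: Fix $m\ge 1$ and a real number $q>0$, $q\neq 1$. Let $\mathcal{C}\ell_{0,m}$ be the real Clifford algebra with identity and generators $e_1,\dots,e_m$ satisfying $e_ie_j+e_je_i=-2\delta_{ij}$; it has basis $e_A=e_{h_1}\cdots e_{h_r}$, $A=\{h_1<\dots<h_r\}\subseteq\{1,\dots,m\}$. The overline denotes Clifford conjugation, i.e. the real-linear anti-automorphism with $\overline{e_i}=-e_i$, and $(\lambda)_0$ denotes the scalar part (the coefficient of the identity) of $\lambda\in\mathcal{C}\ell_{0,m}$. For a multi-index $\alpha=(\alpha_1,\dots,\alpha_m)\in\mathbb{N}^m$ (with $0\in\mathbb{N}$) put $\underline{\mathbf{x}}^\alpha=x_1^{\alpha_1}\cdots x_m^{\alpha_m}$ and $|\alpha|=\sum_i\alpha_i$. The space $\mathcal{P}_k$ is the space of $\mathcal{C}\ell_{0,m}$-valued homogeneous polynomials of degree $k$ in the commuting real variables $x_1,\dots,x_m$, i.e. $R(\underline{\mathbf{x}})=\sum_{|\alpha|=k}\underline{\mathbf{x}}^\alpha a_\alpha$ with $a_\alpha\in\mathcal{C}\ell_{0,m}$ (the variables commute with the $e_i$); by convention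 $\mathcal{P}_{-1}=\{0\}$. The vector variable is $\underline{\mathbf{x}}=\sum_{i=1}^m x_ie_i$, and $\underline{\mathbf{x}}\,\mathcal{P}_{k-1}=\{\underline{\mathbf{x}}R: R\in\mathcal{P}_{k-1}\}$ (left multiplication). The $q$-partial derivative is $$\partial_{x_i}^q f(x_1,\dots,x_m)=\frac{f(x_1,\dots,x_{i-1},qx_i,x_{i+1},\dots,x_m)-f(x_1,\dots,x_m)}{(q-1)x_i},$$ so on polynomials $\partial_{x_i}^q x_i^k=[k]_q x_i^{k-1}$ with $[k]_q=\frac{q^k-1}{q-1}$. The $q$-Dirac operator is $\mathcal{D}^q_{\underline{\mathbf{x}}}=-\sum_{i=1}^m e_i\partial_{x_i}^q$ (acting from the left), and $$\mathcal{M}^q_k=\{M\in\mathcal{P}_k:\mathcal{D}^q_{\underline{\mathbf{x}}}M=0\}.$$ With $[n]_q!=[n]_q[n-1]_q\cdots[1]_q$, $[0]_q!=1$, and $[\alpha]_q!=[\alpha_1]_q!\cdots[\alpha_m]_q!$, the Fischer inner product on $\mathcal{P}_k$ is, for $R_i(\underline{\mathbf{x}})=\sum_{|\alpha|=k}\underline{\mathbf{x}}^\alpha a^i_\alpha$, $i=1,2$, $$\langle R_1,R_2\rangle_{k,q}=\sum_{|\alpha|=k}[\alpha]_q!\,\bigl(\overline{a^1_\alpha}\,a^2_\alpha\bigr)_0 .$$ *)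

(* Defs.v *)
From HB Require Import structures.
From mathcomp Require Import all_boot all_order all_algebra.
From mathcomp Require Import reals.
From mathcomp Require Import mpoly.

Set Implicit Arguments.
Unset Strict Implicit.
Unset Printing Implicit Defensive.

Import Order.TTheory GRing.Theory Num.Theory.
Local Open Scope ring_scope.

(* The Clifford algebra Cl_{0,m}: an element is the family of its coordinates *)
(* in the basis (e_A), where A ranges over the subsets of 'I_m.               *)
Definition clifford (R : Type) (m : nat) := {ffun {set 'I_m} -> R}.

HB.instance Definition _ (R : comNzRingType) (m : nat) :=
  GRing.Lmodule.copy (clifford R m) {ffun {set 'I_m} -> R^o}.

Section CliffordAlgebra.
Variables (R : comNzRingType) (m : nat).
Local Notation Cl := (clifford R m).
Implicit Types (A B C : {set 'I_m}) (a b c : Cl).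

Definition clcoef a A : R := (a : {ffun {set 'I_m} -> R}) A.

Definition clbasis A : Cl := [ffun B => (A == B)%:R].

Definition symdiff A B : {set 'I_m} := (A :\: B) :|: (B :\: A).

(* Sorting the word e_A e_B gives a factor -1 for every pair (i, j) in A x B  *)
(* with j < i (a swap) or j = i (since e_i ^ 2 = -1).                         *)
Definition clsign A B : R :=
  \prod_(i in A) \prod_(j in B) (-1) ^+ (j <= i)%N.

Definition clmul a b : Cl :=
  \sum_A \sum_B (clcoef a A * clcoef b B * clsign A B) *: clbasis (symdiff A B).

Lemma clcoefD a b A : clcoef (a + b) A = clcoef a A + clcoef b A.
Proof. by rewrite /clcoef ffunE. Qed.

Lemma clcoefZ (r : R) a A : clcoef (r *: a) A = r * clcoef a A.
Proof. by rewrite /clcoef ffunE. Qed.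

Lemma clcoef0 A : clcoef 0 A = 0.
Proof. by rewrite /clcoef ffunE. Qed.

Lemma clcoef_basis A B : clcoef (clbasis A) B = (A == B)%:R.
Proof. by rewrite /clcoef ffunE. Qed.

Lemma clcoef_sum (I : Type) (r : seq I) (P : pred I) (F : I -> Cl) A :
  clcoef (\sum_(i <- r | P i) F i) A = \sum_(i <- r | P i) clcoef (F i) A.
Proof.
by apply: (big_morph (fun x => clcoef x A)) => [x y|]; rewrite ?clcoefD ?clcoef0.
Qed.

Lemma clP a b : (forall A, clcoef a A = clcoef b A) -> a = b.
Proof. by move=> h; apply/ffunP => A; apply: h. Qed.

Lemma cl_expand a : a = \sum_A clcoef a A *: clbasis A.
Proof.
apply: clP => B; rewrite clcoef_sum (bigD1 B) //= clcoefZ clcoef_basis eqxx mulr1.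
by rewrite big1 ?addr0 // => A /negbTE h; rewrite clcoefZ clcoef_basis h mulr0.
Qed.

Lemma clmulDl : left_distributive clmul +%R.
Proof.
move=> a b c; rewrite /clmul -big_split; apply: eq_bigr => A _ /=.
rewrite -big_split; apply: eq_bigr => B _ /=.
by rewrite clcoefD !mulrDl scalerDl.
Qed.

Lemma clmulDr : right_distributive clmul +%R.
Proof.
move=> a b c; rewrite /clmul -big_split; apply: eq_bigr => A _ /=.
rewrite -big_split; apply: eq_bigr => B _ /=.
by rewrite clcoefD mulrDr mulrDl scalerDl.
Qed.

Lemma clmulZl (r : R) a b : clmul (r *: a) b = r *: clmul a b.
Proof.
rewrite /clmul scaler_sumr; apply: eq_bigr => A _.
rewrite scaler_sumr; apply: eq_bigr => B _.
by rewrite clcoefZ scalerA !mulrA.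
Qed.

Lemma clmulZr (r : R) a b : clmul a (r *: b) = r *: clmul a b.
Proof.
rewrite /clmul scaler_sumr; apply: eq_bigr => A _.
rewrite scaler_sumr; apply: eq_bigr => B _.
by rewrite clcoefZ scalerA !mulrA (mulrC r).
Qed.

Lemma clmul0l a : clmul 0 a = 0.
Proof. by have := clmulZl 0 0 a; rewrite !scale0r. Qed.

Lemma clmul0r a : clmul a 0 = 0.
Proof. by have := clmulZr 0 a 0; rewrite !scale0r. Qed.

Lemma clmul_suml (I : Type) (r : seq I) (P : pred I) (F : I -> Cl) a :
  clmul (\sum_(i <- r | P i) F i) a = \sum_(i <- r | P i) clmul (F i) a.
Proof.
by apply: (big_morph (fun x => clmul x a)) => [x y|]; rewrite ?clmulDl ?clmul0l.
Qed.

Lemma clmul_sumr (I : Type) (r : seq I) (P : pred I) (F : I -> Cl) a :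
  clmul a (\sum_(i <- r | P i) F i) = \sum_(i <- r | P i) clmul a (F i).
Proof.
by apply: (big_morph (fun x => clmul a x)) => [x y|]; rewrite ?clmulDr ?clmul0r.
Qed.

Lemma clmul_basis A B :
  clmul (clbasis A) (clbasis B) = clsign A B *: clbasis (symdiff A B).
Proof.
rewrite /clmul (bigD1 A) //= (bigD1 B) //= !clcoef_basis !eqxx !mul1r.
rewrite [X in _ + X + _]big1 ?addr0 => [|C /negbTE h]; last first.
  by rewrite !clcoef_basis (eq_sym B) h mulr0 mul0r scale0r.
rewrite big1 ?addr0 // => C /negbTE h; rewrite big1 // => D _.
by rewrite !clcoef_basis (eq_sym A) h !mul0r scale0r.
Qed.

Lemma in_symdiff A B i : (i \in symdiff A B) = (i \in A) (+) (i \in B).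
Proof. by rewrite !inE; case: (i \in A); case: (i \in B). Qed.

Lemma symdiffA : associative symdiff.
Proof. by move=> A B C; apply/setP => i; rewrite !in_symdiff addbA. Qed.

Lemma symdiffC : commutative symdiff.
Proof. by move=> A B; apply/setP => i; rewrite !in_symdiff addbC. Qed.

Lemma prod_symdiff (F : 'I_m -> R) A B : (forall i, F i * F i = 1) ->
  \prod_(i in symdiff A B) F i = (\prod_(i in A) F i) * \prod_(i in B) F i.
Proof.
move=> h; rewrite [LHS]big_mkcond [X in X * _]big_mkcond [X in _ * X]big_mkcond.
rewrite -big_split; apply: eq_bigr => i _ /=; rewrite in_symdiff.
by case: (i \in A); case: (i \in B); rewrite /= ?mulr1 ?mul1r.
Qed.

Lemma clsign_symdiffl A B C :
  clsign (symdiff A B) C = clsign A C * clsign B C.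
Proof.
apply: prod_symdiff => i; rewrite -big_split big1 // => j _ /=.
by rewrite -expr2 sqrr_sign.
Qed.

Lemma clsign_symdiffr A B C :
  clsign C (symdiff A B) = clsign C A * clsign C B.
Proof.
rewrite /clsign -big_split; apply: eq_bigr => i _.
by apply: prod_symdiff => j; rewrite -expr2 sqrr_sign.
Qed.

Lemma clsign_sqr A B : clsign A B * clsign A B = 1.
Proof.
rewrite /clsign -big_split big1 // => i _ /=; rewrite -big_split big1 // => j _ /=.
by rewrite -expr2 sqrr_sign.
Qed.

Lemma clmul_expandl a b : clmul a b = \sum_A clcoef a A *: clmul (clbasis A) b.
Proof.
by rewrite {1}(cl_expand a) clmul_suml; apply: eq_bigr => A _; rewrite clmulZl.
Qed.

Lemma clmul_expandr a b : clmul a b = \sum_B clcoef b B *: clmul a (clbasis B).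
Proof.
by rewrite {1}(cl_expand b) clmul_sumr; apply: eq_bigr => B _; rewrite clmulZr.
Qed.

Lemma clmulA : associative clmul.
Proof.
move=> a b c; rewrite (clmul_expandl a (clmul b c)) (clmul_expandl a b) clmul_suml.
apply: eq_bigr => A _; rewrite clmulZl; congr (_ *: _).
rewrite (clmul_expandl b c) (clmul_expandr _ b) clmul_suml clmul_sumr.
apply: eq_bigr => B _; rewrite clmulZl clmulZr; congr (_ *: _).
rewrite (clmul_expandr _ c) (clmul_expandr (clmul _ _) c) clmul_sumr.
apply: eq_bigr => C _; rewrite clmulZr; congr (_ *: _).
rewrite !clmul_basis clmulZl clmulZr !clmul_basis !scalerA symdiffA.
by rewrite clsign_symdiffl clsign_symdiffr mulrC mulrA.
Qed.

Lemma clmul1l : left_id (clbasis set0) clmul.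
Proof.
move=> a; rewrite [RHS]cl_expand {1}(cl_expand a) clmul_sumr.
apply: eq_bigr => A _; rewrite clmulZr clmul_basis /clsign big_set0 scale1r.
by congr (_ *: clbasis _); apply/setP => i; rewrite in_symdiff inE.
Qed.

Lemma clmul1r : right_id (clbasis set0) clmul.
Proof.
move=> a; rewrite [RHS]cl_expand {1}(cl_expand a) clmul_suml.
apply: eq_bigr => A _; rewrite clmulZl clmul_basis /clsign big1.
  rewrite scale1r; congr (_ *: clbasis _).
  by apply/setP => i; rewrite in_symdiff inE addbF.
by move=> i _; rewrite big_set0.
Qed.

Lemma clone_neq0 : clbasis set0 != 0.
Proof.
apply/eqP => /(congr1 (clcoef^~ set0)) /eqP.
by rewrite clcoef_basis clcoef0 eqxx oner_eq0.
Qed.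

HB.instance Definition _ := GRing.Zmodule_isNzRing.Build Cl
  clmulA clmul1l clmul1r clmulDl clmulDr clone_neq0.

Lemma clscaleAl (r : R) a b : r *: (a * b) = r *: a * b.
Proof. by rewrite [RHS]clmulZl. Qed.

HB.instance Definition _ := GRing.Lmodule_isLalgebra.Build R Cl clscaleAl.

Lemma clscaleAr (r : R) a b : r *: (a * b) = a * (r *: b).
Proof. by rewrite [RHS]clmulZr. Qed.

HB.instance Definition _ := GRing.Lalgebra_isAlgebra.Build R Cl clscaleAr.

Definition clgen (i : 'I_m) : Cl := clbasis [set i].

Lemma clbasisM A B :
  clbasis A * clbasis B = clsign A B *: clbasis (symdiff A B).
Proof. exact: clmul_basis. Qed.

Lemma clbasis0 : clbasis set0 = 1.
Proof. by []. Qed.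

Lemma symdiffvv A : symdiff A A = set0.
Proof. by apply/setP => i; rewrite in_symdiff inE addbb. Qed.

Lemma clsign1 i j : clsign [set i] [set j] = (-1) ^+ (j <= i)%N.
Proof. by rewrite /clsign !big_set1. Qed.

Lemma clgen_anticomm i j :
  clgen i * clgen j + clgen j * clgen i = - (2 * (i == j)%:R).
Proof.
rewrite !clbasisM !clsign1 (symdiffC [set j]).
case: (ltngtP i j) => h.
- rewrite (introF eqP) => [|e]; last by rewrite e ltnn in h.
  by rewrite -scalerDl expr0 expr1 addrN scale0r mulr0 oppr0.
- rewrite (introF eqP) => [|e]; last by rewrite e ltnn in h.
  by rewrite -scalerDl expr0 expr1 addNr scale0r mulr0 oppr0.
have -> : i = j by exact: val_inj.
by rewrite eqxx symdiffvv clbasis0 expr1 !scaleN1r mulr1 -opprD.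
Qed.

Lemma clprod_sorted (s : seq 'I_m) :
  sorted (fun i j : 'I_m => (i < j)%N) s ->
  \prod_(i <- s) clgen i = clbasis [set i in s].
Proof.
elim: s => [_|i s IH] /=.
  by rewrite big_nil -clbasis0; congr clbasis; apply/setP => i; rewrite !inE.
rewrite path_sortedE => [/andP[/allP lt_is ss]|x y z]; last exact: ltn_trans.
rewrite big_cons (IH ss) clbasisM.
have -> : clsign [set i] [set j in s] = 1.
  rewrite /clsign big_set1 big1 // => j; rewrite inE => /lt_is.
  by rewrite ltnNge => /negbTE ->.
rewrite scale1r; congr clbasis; apply/setP => j; rewrite in_symdiff !inE.
case: eqP => [->|] //=; case: (boolP (i \in s)) => // /lt_is.
by rewrite ltnn.
Qed.

Lemma sorted_enum_ord A : sorted (fun i j : 'I_m => (i < j)%N) (enum A).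
Proof.
rewrite /enum_mem sorted_filter // => [x y z|]; first exact: ltn_trans.
have := iota_ltn_sorted 0 m; rewrite -val_enum_ord sorted_map enumT.
by congr is_true; apply: eq_sorted.
Qed.

Lemma clbasis_prod A : clbasis A = \prod_(i <- enum A) clgen i.
Proof.
rewrite clprod_sorted ?sorted_enum_ord //; congr clbasis; apply/setP => i.
by rewrite inE mem_enum.
Qed.

(* Clifford conjugation: the basis word is reversed and every generator       *)
(* changes its sign; see clconj_gen and clconjM.                              *)
Definition clconj a : Cl :=
  \sum_A clcoef a A *: \prod_(i <- rev (enum A)) - clgen i.

Lemma clprod_rev_sorted (s : seq 'I_m) :
  sorted (fun i j : 'I_m => (i < j)%N) s ->
  \prod_(i <- rev s) - clgen i
    = clsign [set i in s] [set i in s] *: clbasis [set i in s].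
Proof.
elim: s => [_|i s IH] /=.
  rewrite big_nil (_ : [set i in [::]] = set0); last first.
    by apply/setP => i; rewrite !inE.
  by rewrite /clsign big_set0 scale1r.
rewrite path_sortedE => [/andP[/allP lt_is ss]|x y z]; last exact: ltn_trans.
rewrite rev_cons big_rcons /= (IH ss).
have -> : [set j in i :: s] = symdiff [set i] [set j in s].
  apply/setP => j; rewrite in_symdiff !inE.
  case: eqP => [->|] //=; case: (boolP (i \in s)) => // /lt_is.
  by rewrite ltnn.
have sis : clsign [set i] [set j in s] = 1.
  rewrite /clsign big_set1 big1 // => j; rewrite inE => /lt_is.
  by rewrite ltnNge => /negbTE ->.
rewrite mulrN -scalerAl clbasisM scalerA -scaleNr (symdiffC [set i]).
congr (_ *: _).
by rewrite clsign_symdiffl !clsign_symdiffr sis clsign1 leqnn expr1 mul1r mulrN1.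
Qed.

Lemma clconj_basis A : clconj (clbasis A) = clsign A A *: clbasis A.
Proof.
rewrite /clconj (bigD1 A) //= clcoef_basis eqxx scale1r.
rewrite [X in _ + X]big1 ?addr0 => [|B /negbTE h]; last first.
  by rewrite clcoef_basis eq_sym h scale0r.
rewrite clprod_rev_sorted ?sorted_enum_ord // (_ : [set i in enum A] = A) //.
by apply/setP => i; rewrite inE mem_enum.
Qed.

Lemma clconj_linear : linear clconj.
Proof.
move=> r a b; rewrite /clconj scaler_sumr -big_split; apply: eq_bigr => A _ /=.
by rewrite clcoefD clcoefZ scalerDl scalerA.
Qed.

HB.instance Definition _ :=
  GRing.isLinear.Build R Cl Cl *:%R clconj clconj_linear.

Lemma clconj_gen i : clconj (clgen i) = - clgen i.
Proof. by rewrite clconj_basis clsign1 leqnn expr1 scaleN1r. Qed.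

Lemma clconjM a b : clconj (a * b) = clconj b * clconj a.
Proof.
rewrite (cl_expand a) mulr_suml !linear_sum mulr_sumr; apply: eq_bigr => A _.
rewrite -scalerAl !linearZ /= -scalerAr; congr (_ *: _).
rewrite (cl_expand b) mulr_sumr !linear_sum mulr_suml; apply: eq_bigr => B _.
rewrite -scalerAr !linearZ /= -scalerAl; congr (_ *: _).
rewrite clbasisM linearZ /= !clconj_basis -scalerAl -scalerAr !scalerA clbasisM.
rewrite (symdiffC B) !scalerA; congr (_ *: _).
rewrite clsign_symdiffl !clsign_symdiffr.
rewrite (mulrC (clsign A A) (clsign A B)) -(mulrA (clsign A B)).
rewrite (mulrA (clsign A B) (clsign A B)) clsign_sqr mul1r.
by rewrite (mulrC (clsign B A)) mulrA (mulrC (clsign A A)).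
Qed.

Definition clscalar a : R := clcoef a set0.

End CliffordAlgebra.

Section QDirac.
Variables (R : realType) (m : nat).
Local Notation Cl := (clifford R m).
Local Notation P := {mpoly Cl[m]}.
Implicit Types (q : R) (p : P) (i : 'I_m).

Definition qnum q (n : nat) : R := (q ^+ n - 1) / (q - 1).

Definition qfact q (n : nat) : R := \prod_(1 <= j < n.+1) qnum q j.

Definition qmfact q (al : 'X_{1..m}) : R := \prod_(i < m) qfact q (al i).

(* p(x_1, ..., q x_i, ..., x_m) *)
Definition qdilate q i p : P :=
  mmap (@mpolyC m Cl) (fun j => if j == i then (q%:A : Cl) *: 'X_j else 'X_j) p.

(* Quotient of p by x_i (the terms of p without x_i are dropped). *)
Definition divX i p : P :=
  \sum_(al <- msupp p | (0 < al i)%N) p@_al *: 'X_[al - U_(i)].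

Definition qpartial q i p : P :=
  ((q - 1)^-1%:A : Cl) *: divX i (qdilate q i p - p).

Lemma cl_scalar_comm (r : R) (a : Cl) : r%:A * a = r *: a.
Proof. by rewrite -scalerAl mul1r. Qed.

Lemma cl_mul_scalar (r : R) (a : Cl) : a * r%:A = r *: a.
Proof. by rewrite -scalerAr mulr1. Qed.

Lemma cl_scale_sub1 (r : R) (a : Cl) : r *: a - a = (r - 1) *: a.
Proof. by rewrite scalerBl scale1r. Qed.

Lemma qdilate_sum q i p :
  qdilate q i p = \sum_(al <- msupp p) (q ^+ al i *: p@_al) *: 'X_[al].
Proof.
apply: eq_bigr => al _; rewrite mul_mpolyC.
have -> : mmap1 (fun j => if j == i then (q%:A : Cl) *: 'X_j else 'X_j) al
            = ((q ^+ al i)%:A : Cl) *: 'X_[al] :> P.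
  rewrite mpolyXE_id /mmap1.
  have h j : (if j == i then (q%:A : Cl) *: 'X_j else 'X_j) ^+ al j
             = ((if j == i then q ^+ al i else 1)%:A : Cl) *: 'X_j ^+ al j :> P.
    case: eqP => [->|_]; last by rewrite scale1r scale1r.
    elim: (al i) => [|n IHn]; first by rewrite !expr0 !scale1r.
    rewrite !exprS IHn -scalerAl -!mul_mpolyC !mulrA.
    rewrite -(mulrA _ 'X_i) -(commr_mpolyX U_(i)) mulrA -mpolyCM.
    by rewrite cl_scalar_comm scalerA -!mulrA.
  rewrite (eq_bigr _ (fun j _ => h j)).
  rewrite [in RHS](_ : q ^+ al i = \prod_(j < m) (if j == i then q ^+ al i else 1));
    last by rewrite -big_mkcond big_pred1_eq.
  elim/big_rec3: _ => [|j x y z _ ->]; first by rewrite !scale1r.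
  rewrite -scalerAl -!mul_mpolyC !mulrA.
  set u := 'X_j ^+ al j.
  have -> : u = 'X_[U_(j) *+ al j] by rewrite /u mpolyXn.
  rewrite -(mulrA _ 'X_[_]) -commr_mpolyX mulrA -mpolyCM.
  by rewrite cl_scalar_comm scalerA.
by rewrite (scalerA p@_al) cl_mul_scalar.
Qed.

Lemma mcoeff_sumX (s : seq 'X_{1..m}) (F : 'X_{1..m} -> Cl) al :
  uniq s -> (forall be, be \notin s -> F be = 0) ->
  (\sum_(be <- s) F be *: 'X_[be] : P)@_al = F al.
Proof.
move=> us F0; rewrite raddf_sum /=.
have [als|als] := boolP (al \in s).
  rewrite (bigD1_seq al) //= mcoeffZ mcoeffX eqxx mulr1 big1 ?addr0 //.
  by move=> be /negbTE h; rewrite mcoeffZ mcoeffX h mulr0.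
rewrite F0 // big_seq big1 // => be bes; rewrite mcoeffZ mcoeffX.
case: eqP => [e|_]; last by rewrite mulr0.
by rewrite -e bes in als.
Qed.

Lemma mcoeff_qdilate q i p al : (qdilate q i p)@_al = q ^+ al i *: p@_al.
Proof.
rewrite qdilate_sum (mcoeff_sumX (F := fun al => q ^+ al i *: p@_al)) //.
by move=> be /memN_msupp_eq0 ->; rewrite scaler0.
Qed.

Lemma mcoeff_divX i p al : (divX i p)@_al = p@_(al + U_(i)).
Proof.
rewrite /divX raddf_sum /= -(mcoeff_sumX (s := msupp p) (F := fun al => p@_al)) //.
  rewrite raddf_sum /= big_mkcond; apply: eq_bigr => be _ /=.
  rewrite !mcoeffZ !mcoeffX; case: ifP => [be_i|/negbT].
    congr (_ * _%:R); congr nat_of_bool; apply/eqP/eqP => [<-|->].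
      rewrite submK //; apply/mnm_lepP => j; rewrite mnm1E.
      by case: eqP => [<-|].
    by rewrite addmK.
  case: eqP => [->|]; rewrite ?mulr0 //.
  by rewrite mnmDE mnm1E eqxx addn1.
by move=> be /memN_msupp_eq0.
Qed.

Lemma mcoeff_qpartial q i p al : q != 1 ->
  (qpartial q i p)@_al = qnum q (al i).+1 *: p@_(al + U_(i)).
Proof.
move=> q1; rewrite mcoeffZ mcoeff_divX mcoeffB mcoeff_qdilate cl_scalar_comm.
rewrite mnmDE mnm1E eqxx addn1 cl_scale_sub1 scalerA.
by rewrite /qnum mulrC.
Qed.

(* The quotient formula of the q-partial derivative holds in {mpoly Cl[m]}.   *)
Lemma qpartialE q i p : q != 1 ->
  ((q - 1)%:A : Cl) *: ('X_i * qpartial q i p) = qdilate q i p - p.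
Proof.
move=> q1; apply/mpolyP => al.
rewrite mcoeffZ cl_scalar_comm mcoeffB mcoeff_qdilate.
rewrite -commr_mpolyX.
have [al_i|] := boolP (0 < al i)%N.
  have le_i : (U_(i) <= al)%MM.
    by apply/mnm_lepP => j; rewrite mnm1E; case: eqP => [<-|].
  rewrite -{1}(submK le_i) addmC mcoeffMX mcoeff_qpartial // submK //.
  rewrite mnmBE mnm1E eqxx subn1 prednK // scalerA cl_scale_sub1.
  by rewrite /qnum mulrC divfK // subr_eq0.
rewrite -leqNgt leqn0 => /eqP al_i; rewrite al_i scale1r subrr.
suff -> : (qpartial q i p * 'X_i)@_al = 0 by rewrite scaler0.
apply/memN_msupp_eq0; rewrite (perm_mem (msuppMX _ _)).
by apply/mapP => -[be _ e]; move: al_i; rewrite e mnmDE mnm1E eqxx.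
Qed.

Lemma qpartialX q i al : q != 1 ->
  qpartial q i 'X_[al] = ((qnum q (al i))%:A : Cl) *: 'X_[al - U_(i)].
Proof.
move=> q1; apply/mpolyP => be.
rewrite mcoeff_qpartial // mcoeffZ cl_scalar_comm !mcoeffX.
have [e|ne] := eqVneq al (be + U_(i))%MM.
  by rewrite e mnmDE mnm1E eqxx addn1 addmK eqxx.
rewrite scaler0; case: eqP => [e|_]; last by rewrite scaler0.
have [al_i|al_i] := posnP (al i); first by rewrite al_i /qnum expr0 subrr mul0r scale0r.
case/eqP: ne; rewrite -e submK //; apply/mnm_lepP => j; rewrite mnm1E.
by case: eqP => [<-|].
Qed.

Definition vecvar : P := \sum_(i < m) (clgen R i)%:MP * 'X_i.

Definition qdirac q p : P := - \sum_(i < m) (clgen R i)%:MP * qpartial q i p.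

(* The degree is an integer so that the space of degree k - 1 is {0} if k = 0. *)
Definition homspace (d : int) (p : P) : Prop :=
  if d is Posz k then p \is k.-homog else p = 0.

Definition qmonogenic q (k : nat) (p : P) : Prop :=
  homspace k%:Z p /\ qdirac q p = 0.

Definition vecvar_mul (U : P -> Prop) (p : P) : Prop :=
  exists2 r, U r & p = vecvar * r.

Definition fischer q (k : nat) (p1 p2 : P) : R :=
  \sum_(al : 'X_{1..m < k.+1} | mdeg al == k)
    qmfact q al * clscalar (clconj p1@_al * p2@_al).

(* {mpoly Cl[m]} is a left module over Cl: the real r scales through r%:A.    *)
Definition real_subspace (U : P -> Prop) : Prop :=
  [/\ U 0,
      forall p1 p2, U p1 -> U p2 -> U (p1 + p2)
    & forall (r : R) p, U p -> U ((r%:A : Cl) *: p)].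

Definition direct_sum (V U W : P -> Prop) : Prop :=
  [/\ real_subspace U, real_subspace W,
      forall p, V p <-> exists u w, [/\ U u, W w & p = u + w]
    & forall p, U p -> W p -> p = 0].

End QDirac.

(* Main.v *)
Require Import Defs.
From HB Require Import structures.
From mathcomp Require Import all_boot all_order all_algebra.
From mathcomp Require Import reals mpoly.

Import Order.TTheory GRing.Theory Num.Theory.
Local Open Scope ring_scope.

Set Implicit Arguments.
Unset Strict Implicit.
Unset Printing Implicit Defensive.

(** The whole statement rests on one duality: for the Fischer product, left
    multiplication by the vector variable x is the adjoint of the q-Dirac
    operator D,
      <x r, p>_(k+1) = <r, D p>_k
    (lemma [fischer_vecvar]). Two facts make it work: the weights [al]_q! turn
    the shift al |-> al + U_(i) into the factor [al_i + 1]_q produced by the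
    q-derivative, and the conjugate of e_i is - e_i, which is the sign in D.

    Orthogonality is then immediate: if D u = 0, then <u, x r> = <D u, r> = 0.
    Since q > 0 makes every [n]_q with n > 0 positive, the Fischer product is
    positive definite ([fischer_eq0]), so an element of both subspaces, being
    orthogonal to itself, vanishes.

    For the existence of a decomposition of p in P_(k+1), look for r in P_k with
    D (x r) = D p; then p = (p - x r) + x r. Such an r exists because the
    endomorphism r |-> D (x r) of P_k is injective and P_k has finite dimension
    over the reals ([homog_inj_surj]). It is injective because D (x r) = 0 gives
    <x r, x r> = <r, D (x r)> = 0, hence x r = 0, and x is not a left divisor of
    zero ([vecvarM_inj]). In degree 0 every polynomial is q-monogenic. *)

(** * The scalar product of the Clifford algebra *)

Section CliffordInnerProduct.
Variables (R : realType) (m : nat).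
Local Notation Cl := (clifford R m).
Implicit Types (a b : Cl) (i : 'I_m).

Lemma symdiff_eq0 (A B : {set 'I_m}) : (symdiff A B == set0) = (A == B).
Proof.
apply/eqP/eqP => [h|->]; last exact: symdiffvv.
apply/setP => i; have := in_symdiff A B i.
by rewrite h inE; case: (i \in A); case: (i \in B).
Qed.

(** The basis (e_A) is orthonormal for (a, b) |-> (conj a * b)_0: the conjugate
    of e_A is its inverse, and e_A e_B has a scalar part only if A = B. This is
    where symmetry and positivity of the Fischer product come from. *)
Lemma clscalar_conjM a b :
  clscalar (clconj a * b) = \sum_A clcoef a A * clcoef b A.
Proof.
rewrite (cl_expand a) linear_sum mulr_suml /clscalar clcoef_sum.
rewrite -(cl_expand a); apply: eq_bigr => A _.
rewrite linearZ /= clconj_basis scalerA -scalerAl clcoefZ.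
rewrite {1}(cl_expand b) mulr_sumr clcoef_sum (bigD1 A) //=.
rewrite [X in _ + X]big1 ?addr0 => [|B BA]; last first.
  rewrite -scalerAr clcoefZ clbasisM clcoefZ clcoef_basis symdiff_eq0.
  by rewrite eq_sym (negbTE BA) !mulr0.
rewrite -scalerAr clcoefZ clbasisM clcoefZ clcoef_basis symdiff_eq0 eqxx.
by rewrite mulr1 mulrCA -!mulrA clsign_sqr mulr1 mulrC.
Qed.

Lemma clscalar_conj_ge0 a : 0 <= clscalar (clconj a * a).
Proof.
by rewrite clscalar_conjM sumr_ge0 // => A _; rewrite -expr2 sqr_ge0.
Qed.

Lemma clscalar_conj_eq0 a : clscalar (clconj a * a) = 0 -> a = 0.
Proof.
rewrite clscalar_conjM => /psumr_eq0P h; apply: clP => A; rewrite clcoef0.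
apply/eqP; rewrite -sqrf_eq0 expr2 h // => B _.
by rewrite -expr2 sqr_ge0.
Qed.

Lemma clscalar_conjC a b : clscalar (clconj a * b) = clscalar (clconj b * a).
Proof. by rewrite !clscalar_conjM; apply: eq_bigr => A _; rewrite mulrC. Qed.

Lemma clgen_sqr i : clgen R i * clgen R i = -1.
Proof. by rewrite clbasisM clsign1 leqnn expr1 symdiffvv clbasis0 scaleN1r. Qed.

Lemma clgen_mul_eq0 i a : clgen R i * a = 0 -> a = 0.
Proof.
move=> /(congr1 (fun b => - clgen R i * b)).
by rewrite mulr0 mulrA mulNr clgen_sqr opprK mul1r.
Qed.

End CliffordInnerProduct.

(** * Positivity and recurrence of the q-factorials *)

Section QFactorials.
Variables (R : realType) (m : nat) (q : R).
Hypotheses (q_gt0 : 0 < q) (q_neq1 : q != 1).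

Lemma qnum_gt0 n : 0 < qnum q n.+1.
Proof.
(* Geometric sum: [n + 1]_q = 1 + q + ... + q ^ n. *)
rewrite /qnum subrX1 mulrAC divff ?subr_eq0 // mul1r.
rewrite big_ord_recl expr0 ltr_wpDr ?ltr01 // sumr_ge0 // => i _.
by rewrite exprn_ge0 // ltW.
Qed.

Lemma qfact_gt0 n : 0 < qfact q n.
Proof.
rewrite /qfact big_add1 /= big_mkord.
by apply: prodr_gt0 => i _; exact: qnum_gt0.
Qed.

Lemma qmfact_gt0 (al : 'X_{1..m}) : 0 < qmfact q al.
Proof. by apply: prodr_gt0 => i _; exact: qfact_gt0. Qed.

Lemma qmfactS (al : 'X_{1..m}) i :
  qmfact q (al + U_(i)) = qmfact q al * qnum q (al i).+1.
Proof.
rewrite /qmfact (bigD1 i) //= [in RHS](bigD1 i) //= mnmDE mnm1E eqxx addn1.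
rewrite {1}/qfact big_nat_recr //= -/(qfact q (al i)) mulrAC.
congr (_ * _ * _); apply: eq_bigr => j ji.
by rewrite mnmDE mnm1E eq_sym (negbTE ji) addn0.
Qed.

End QFactorials.

(** * Coefficients and degrees of x p and D p *)

Section FischerDecomposition.
Variables (R : realType) (m : nat).
Local Notation Cl := (clifford R m).
Local Notation P := {mpoly Cl[m]}.
Implicit Types (p r : P) (al be : 'X_{1..m}) (i : 'I_m).

Lemma mnm1_le be i : (U_(i) <= be)%MM = (0 < be i)%N.
Proof.
apply/mnm_lepP/idP => [/(_ i)|be_i j]; rewrite mnm1E ?eqxx //.
by case: eqP => [<-|].
Qed.

Lemma mcoeffXM i p be :
  ('X_i * p)@_be = if (0 < be i)%N then p@_(be - U_(i)) else 0.
Proof.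
rewrite -commr_mpolyX; case: ifP => [be_i|/negbT].
  have le_i : (U_(i) <= be)%MM by rewrite mnm1_le.
  by rewrite -{1}(submK le_i) addmC mcoeffMX.
rewrite -mnm1_le => nle; apply/memN_msupp_eq0.
rewrite (perm_mem (msuppMX _ _)); apply/mapP => -[al _ e].
by case/negP: nle; rewrite e lem_addr.
Qed.

Lemma mcoeff_vecvarM p be :
  (vecvar R m * p)@_be =
  \sum_(i | (0 < be i)%N) clgen R i * p@_(be - U_(i)).
Proof.
rewrite mulr_suml raddf_sum [in RHS]big_mkcond; apply: eq_bigr => i _ /=.
by rewrite -mulrA mcoeffCM mcoeffXM; case: ifP; rewrite ?mulr0.
Qed.

Lemma mcoeff_qdirac q p al : q != 1 ->
  (qdirac q p)@_al =
  - \sum_i qnum q (al i).+1 *: (clgen R i * p@_(al + U_(i))).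
Proof.
move=> q1; rewrite mcoeffN raddf_sum; congr (- _); apply: eq_bigr => i _ /=.
by rewrite mcoeffCM mcoeff_qpartial // -scalerAr.
Qed.

Lemma vecvar_homog : vecvar R m \is 1.-homog.
Proof.
apply: rpred_sum => i _; rewrite mul_mpolyC.
by apply: dhomogZ; rewrite dhomogX /= mdeg1.
Qed.

Lemma qdiracD q p1 p2 : q != 1 ->
  qdirac q (p1 + p2) = qdirac q p1 + qdirac q p2.
Proof.
move=> q1; apply/mpolyP => al.
transitivity ((qdirac q p1)@_al + (qdirac q p2)@_al); last by rewrite mcoeffD.
rewrite [LHS](mcoeff_qdirac _ _ q1) [X in _ = X + _](mcoeff_qdirac _ _ q1).
rewrite [X in _ = _ + X](mcoeff_qdirac _ _ q1) -[RHS]opprD.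
rewrite -big_split; congr (- _); apply: eq_bigr => i _ /=.
by rewrite (mcoeffD _ p1) mulrDr scalerDr.
Qed.

Lemma qdiracZ q (c : R) p : q != 1 ->
  qdirac q ((c%:A : Cl) *: p) = (c%:A : Cl) *: qdirac q p.
Proof.
move=> q1; apply/mpolyP => al.
rewrite [RHS]mcoeffZ [RHS]cl_scalar_comm [LHS](mcoeff_qdirac _ _ q1).
rewrite [X in _ = _ *: X](mcoeff_qdirac _ _ q1).
rewrite scalerN scaler_sumr; congr (- _); apply: eq_bigr => i _ /=.
by rewrite mcoeffZ cl_scalar_comm -scalerAr !scalerA mulrC.
Qed.

Lemma qdirac0 q : q != 1 -> qdirac q (0 : P) = 0.
Proof. by move=> q1; have := qdiracZ 0 0 q1; rewrite !scale0r. Qed.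

Lemma vecvarMZ (c : R) p :
  vecvar R m * ((c%:A : Cl) *: p) = (c%:A : Cl) *: (vecvar R m * p).
Proof.
apply/mpolyP => be.
rewrite [RHS]mcoeffZ [RHS]cl_scalar_comm [LHS]mcoeff_vecvarM.
rewrite [X in _ = _ *: X]mcoeff_vecvarM scaler_sumr.
by apply: eq_bigr => i _; rewrite mcoeffZ cl_scalar_comm -scalerAr.
Qed.

Lemma homogP k p :
  reflect (forall al, mdeg al != k -> p@_al = 0) (p \is k.-homog).
Proof.
apply: (iffP idP) => [hp al|h]; first exact: dhomog_nemf_coeff.
apply/dhomogP => al al_p; apply/eqP; apply: contraLR al_p => /h e.
by rewrite mcoeff_msupp e eqxx.
Qed.

Lemma vecvarM_homog k r : r \is k.-homog -> vecvar R m * r \is k.+1.-homog.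
Proof.
by move=> hr; rewrite -add1n; apply: dhomogM => //; exact: vecvar_homog.
Qed.

Lemma qdirac_homog q k p : q != 1 ->
  p \is k.+1.-homog -> qdirac q p \is k.-homog.
Proof.
move=> q1 /homogP hp; apply/homogP => al ne_k; rewrite (mcoeff_qdirac _ _ q1).
rewrite big1 ?oppr0 // => i _; rewrite hp ?mulr0 ?scaler0 //.
by rewrite mdegD mdeg1 addn1 eqSS.
Qed.

Lemma qdirac_const q p : q != 1 -> p \is 0.-homog -> qdirac q p = 0.
Proof.
move=> q1 /homogP hp; apply/mpolyP => al; rewrite (mcoeff_qdirac _ _ q1) mcoeff0.
rewrite big1 ?oppr0 // => i _; rewrite hp ?mulr0 ?scaler0 //.
by rewrite mdegD mdeg1 addn1.
Qed.

Lemma mcoeff_vecvar1 i : (vecvar R m)@_(U_(i)) = clgen R i.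
Proof.
rewrite -(mulr1 (vecvar R m)) mcoeff_vecvarM (bigD1 i) ?mnm1E ?eqxx //= big1.
  by rewrite addr0 -{1}[U_(i)%MM]add0m addmK mcoeff1 eqxx mulr1.
by move=> j /andP[h /negbTE ji]; move: h; rewrite mnm1E eq_sym ji.
Qed.

Lemma vecvar_neq0 : (0 < m)%N -> vecvar R m != 0.
Proof.
move=> m_gt0; apply/eqP => /(congr1 (mcoeff U_(Ordinal m_gt0))).
rewrite mcoeff_vecvar1 mcoeff0 -[clgen _ _]mulr1 => /clgen_mul_eq0 /eqP.
by rewrite oner_eq0.
Qed.

(** The polynomial ring over the Clifford algebra has zero divisors, but the
    leading coefficient of x is a generator, hence invertible: multiplication
    by x cannot kill the leading term of r. *)
Lemma vecvarM_inj r : (0 < m)%N -> vecvar R m * r = 0 -> r = 0.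
Proof.
move=> m_gt0 xr0; apply/eqP; rewrite -mleadc_eq0; apply/eqP.
have := mleadcM (vecvar R m) r; rewrite xr0 mcoeff0.
have /mdeg1P[i /eqP ->] : mdeg (mlead (vecvar R m)) == 1%N.
  apply/eqP; apply: (dhomogP _ _ _ vecvar_homog).
  exact/mlead_supp/vecvar_neq0.
by rewrite mcoeff_vecvar1 => /esym; apply: clgen_mul_eq0.
Qed.

(** * Multiplication by x is adjoint to the q-Dirac operator *)

Lemma fischerC q k p r : fischer q k p r = fischer q k r p.
Proof. by apply: eq_bigr => al _; rewrite clscalar_conjC. Qed.

Lemma fischer0 q k p : fischer q k p 0 = 0.
Proof.
by apply: big1 => al _; rewrite mcoeff0 mulr0 /clscalar clcoef0 mulr0.
Qed.

Lemma fischer_eq0 q k p : 0 < q -> q != 1 -> p \is k.-homog ->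
  fischer q k p p = 0 -> p = 0.
Proof.
move=> q0 q1 /homogP hp /psumr_eq0P h; apply/mpolyP => al; rewrite mcoeff0.
have [al_k|/hp //] := eqVneq (mdeg al) k.
have lt_k : (mdeg al < k.+1)%N by rewrite al_k.
have := h _ (BMultinom lt_k); rewrite /= al_k eqxx => /(_ _ isT) e.
apply: clscalar_conj_eq0; apply/eqP.
rewrite -(mulrI_eq0 _ (lregP (lt0r_neq0 (qmfact_gt0 q0 q1 al)))) e // => be _.
by rewrite mulr_ge0 ?clscalar_conj_ge0 // ltW // qmfact_gt0.
Qed.

(** Substituting al = be - U_(i): the multi-indices of degree k+1 divisible by
    x_i are the shifts by U_(i) of those of degree k. *)
Lemma sum_mdegS (V : nmodType) (F : 'X_{1..m} -> V) k i :
  \sum_(be : 'X_{1..m < k.+2} | (mdeg be == k.+1) && (0 < be i)%N) F be =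
  \sum_(al : 'X_{1..m < k.+1} | mdeg al == k) F (al + U_(i))%MM.
Proof.
have up (al : 'X_{1..m < k.+1}) : (mdeg (al + U_(i)) < k.+2)%N.
  by rewrite mdegD mdeg1 addn1 ltnS bmdeg.
pose h (al : 'X_{1..m < k.+1}) := BMultinom (up al).
pose h' (be : 'X_{1..m < k.+2}) : 'X_{1..m < k.+1} :=
  insubd bm0 (be - U_(i))%MM.
rewrite (reindex_onto h h') => [|be /andP[/eqP be_k be_i]] /=.
  apply: eq_bigl => al; rewrite mdegD mdeg1 addn1 eqSS mnmDE mnm1E eqxx addn1.
  rewrite andbT; case: eqP => //= _; apply/eqP; apply: val_inj.
  by rewrite /h' /= addmK val_insubd bmdeg.
have le_i : (U_(i) <= be)%MM by rewrite mnm1_le.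
have e : mdeg (be - U_(i))%MM = k.
  by have := congr1 mdeg (submK le_i); rewrite mdegD mdeg1 addn1 be_k => -[].
by apply: val_inj; rewrite /= /h' val_insubd e ltnSn submK.
Qed.

(** After the shift al = be - U_(i), the weight splits as
    [al + U_(i)]_q! = [al]_q! [al_i + 1]_q, and the second factor is the one that
    the q-derivative in the direction i puts on the coefficient of p. *)
Lemma fischer_vecvar q k r p : q != 1 ->
  fischer q k.+1 (vecvar R m * r) p = fischer q k r (qdirac q p).
Proof.
move=> q1.
(* The contribution to <x r, p> of the monomial be and the generator e_i. *)
pose T be i := qmfact q be *
  - clscalar (clconj r@_(be - U_(i)) * (clgen R i * p@_be)).
transitivity (\sum_(be : 'X_{1..m < k.+2} | mdeg be == k.+1)
                \sum_(i | (0 < be i)%N) T be i).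
  apply: eq_bigr => be _; rewrite mcoeff_vecvarM linear_sum mulr_suml.
  rewrite /clscalar clcoef_sum mulr_sumr; apply: eq_bigr => i _ /=.
  by rewrite clconjM clconj_gen mulrN mulNr -mulrA -scaleN1r clcoefZ mulN1r.
rewrite (exchange_big_dep predT) //=.
rewrite (eq_bigr _ (fun i _ => sum_mdegS (T^~ i) k i)) exchange_big /=.
apply: eq_bigr => al _; rewrite (mcoeff_qdirac _ _ q1) mulrN -scaleN1r /clscalar.
rewrite clcoefZ mulN1r mulr_sumr clcoef_sum -sumrN mulr_sumr.
apply: eq_bigr => i _.
by rewrite /T addmK qmfactS -scalerAr clcoefZ !mulrN -[in LHS]mulrA.
Qed.

Lemma qdirac_vecvar_inj q k r : (0 < m)%N -> 0 < q -> q != 1 ->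
  r \is k.-homog -> qdirac q (vecvar R m * r) = 0 -> r = 0.
Proof.
move=> m_gt0 q0 q1 hr e; apply: vecvarM_inj => //.
apply: (@fischer_eq0 q k.+1) => //; first exact: vecvarM_homog.
by rewrite fischer_vecvar // e fischer0.
Qed.

(** * Surjectivity by finite dimension *)

(** P_k has finite dimension over the reals, although the polynomial ring only
    carries a module structure over the Clifford algebra; so the endomorphism is
    transported to the real coordinate space indexed by the pairs (al, A) with
    |al| = k, where injective endomorphisms are surjective. *)
Lemma homog_inj_surj k (phi : P -> P) :
    (forall p, p \is k.-homog -> phi p \is k.-homog) ->
    {morph phi : p1 p2 / p1 + p2} ->
    (forall (c : R) p, phi ((c%:A : Cl) *: p) = (c%:A : Cl) *: phi p) ->
    (forall p, p \is k.-homog -> phi p = 0 -> p = 0) ->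
  forall p, p \is k.-homog -> exists2 r, r \is k.-homog & phi r = p.
Proof.
move=> phi_homog phiD phiZ phi_inj p hp.
pose I : finType := {al : 'X_{1..m < k.+1} | mdeg al == k}.
pose V : vectType R := {ffun I * {set 'I_m} -> R^o}.
pose cl (f : V) (al : I) : Cl := [ffun A => f (al, A)].
pose pol (f : V) : P := \sum_(al : I) cl f al *: 'X_[val al].
pose coord (r : P) : V :=
  [ffun x : I * {set 'I_m} => (clcoef r@_(val x.1) x.2 : R^o)].
have mpol f (al : I) : (pol f)@_(val al) = cl f al.
  rewrite raddf_sum /= (bigD1 al) //= mcoeffZ mcoeffX eqxx mulr1 big1 ?addr0 //.
  move=> be /negbTE ne; rewrite mcoeffZ mcoeffX.
  case: eqP => [/val_inj/val_inj e|_]; last by rewrite mulr0.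
  by rewrite e eqxx in ne.
have hpol f : pol f \is k.-homog.
  by apply: rpred_sum => al _; apply: dhomogZ; rewrite dhomogX; apply: (valP al).
have polK r : r \is k.-homog -> pol (coord r) = r.
  move=> hr; apply/mpolyP => al.
  have [al_k|al_k] := eqVneq (mdeg al) k; last first.
    by rewrite !(dhomog_nemf_coeff _ al_k).
  have lt_k : (mdeg al < k.+1)%N by rewrite al_k.
  have b_k : mdeg (BMultinom lt_k) == k by rewrite /= al_k.
  pose b : I := exist (fun be : 'X_{1..m < k.+1} => mdeg be == k) _ b_k.
  rewrite -[al]/(val b : 'X_{1..m}) mpol; apply: clP => A.
  by rewrite /clcoef /cl !ffunE.
have coord_inj r : r \is k.-homog -> coord r = 0 -> r = 0.
  move=> hr e; rewrite -(polK r hr) e /pol big1 // => al _.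
  rewrite (_ : cl 0 al = 0) ?scale0r //.
  by apply: clP => A; rewrite /clcoef !ffunE.
have pol_lin c f g : pol (c *: f + g) = (c%:A : Cl) *: pol f + pol g.
  rewrite scaler_sumr -big_split; apply: eq_bigr => al _ /=.
  rewrite scalerA cl_scalar_comm -scalerDl; congr (_ *: _).
  by apply: clP => A; rewrite clcoefD clcoefZ /clcoef !ffunE.
have coord_lin c r s : coord ((c%:A : Cl) *: r + s) = c *: coord r + coord s.
  apply/ffunP => x; rewrite !ffunE mcoeffD mcoeffZ cl_scalar_comm.
  by rewrite clcoefD clcoefZ.
have lin : linear (coord \o phi \o pol).
  by move=> c f g; rewrite /= pol_lin phiD phiZ coord_lin.
pose h := GRing.isLinear.Build _ _ _ _ _ lin.
pose g : {linear V -> V} := HB.pack (coord \o phi \o pol) h.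
have ker0 : lker (linfun g) == 0%VS.
  apply/lker0P => f1 f2; rewrite !lfunE => e.
  apply/eqP; rewrite -subr_eq0; apply/eqP.
  have {}e : g (f1 - f2) = 0 by rewrite linearB e subrr.
  have p0 : pol (f1 - f2) = 0.
    apply: phi_inj; first exact: hpol.
    by apply: coord_inj => //; apply: phi_homog.
  apply/ffunP => -[al A]; have := mpol (f1 - f2) al.
  rewrite p0 mcoeff0 => /(congr1 (fun c => clcoef c A)).
  by rewrite clcoef0 /clcoef ffunE => <-; rewrite [RHS]ffunE.
pose f := (linfun g)^-1%VF (coord p).
have e : coord (phi (pol f)) = coord p.
  by have := lker0_lfunVK ker0 (coord p); rewrite lfunE.
exists (pol f) => //.
by rewrite -(polK p hp) -e (polK _ (phi_homog _ (hpol f))).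
Qed.

(** * The Fischer decomposition *)

Lemma real_subspace_homspace d : real_subspace (@homspace R m d).
Proof.
case: d => [k|n]; split => /=.
- exact: dhomog0.
- by move=> p1 p2; apply: dhomogD.
- by move=> c p; apply: dhomogZ.
- by [].
- by move=> p1 p2 -> ->; rewrite addr0.
- by move=> c p ->; rewrite scaler0.
Qed.

Lemma real_subspace_qmonogenic q k : q != 1 ->
  real_subspace (@qmonogenic R m q k).
Proof.
move=> q1; split.
- by split; [exact: dhomog0 | exact: qdirac0].
- move=> p1 p2 [h1 d1] [h2 d2]; split; first exact: dhomogD.
  by rewrite qdiracD // d1 d2 addr0.
- move=> c p [h d]; split; first exact: dhomogZ.
  by rewrite qdiracZ // d scaler0.
Qed.

Lemma real_subspace_vecvar_mul (U : P -> Prop) :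
  real_subspace U -> real_subspace (vecvar_mul U).
Proof.
case=> U0 UD UZ; split.
- by exists 0 => //; rewrite mulr0.
- move=> _ _ [r1 U1 ->] [r2 U2 ->]; exists (r1 + r2); first exact: UD.
  by rewrite mulrDr.
- move=> c _ [r Ur ->]; exists ((c%:A : Cl) *: r); first exact: UZ.
  by rewrite vecvarMZ.
Qed.

Lemma subzS1 k : k.+1%:Z - 1 = k%:Z.
Proof. by rewrite -addn1 PoszD addrK. Qed.

Lemma vecvar_mul_homog k p :
  vecvar_mul (@homspace R m (k%:Z - 1)) p -> p \is k.-homog.
Proof.
case=> r hr ->; case: k hr => [/= ->|k]; first by rewrite mulr0 dhomog0.
by rewrite subzS1 => /vecvarM_homog.
Qed.

Lemma fischer_orthogonal q k u w : q != 1 ->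
  @qmonogenic R m q k u -> vecvar_mul (@homspace R m (k%:Z - 1)) w ->
  fischer q k u w = 0.
Proof.
move=> q1 [_ Du0] [r hr ->]; case: k hr => [/= ->|k _].
  by rewrite mulr0 fischer0.
by rewrite fischerC fischer_vecvar // Du0 fischer0.
Qed.

(** For k > 0 the component in x P_(k-1) is x r, where r solves D (x r) = D p;
    for k = 0 it is zero, since D lowers the degree. *)
Lemma qdirac_decomposition q k p : (0 < m)%N -> 0 < q -> q != 1 ->
  p \is k.-homog ->
  exists u w, [/\ qmonogenic q k u,
                  vecvar_mul (@homspace R m (k%:Z - 1)) w & p = u + w].
Proof.
move=> m0 q0 q1; case: k => [|k] hp.
  exists p, 0; split; last by rewrite addr0.
    by split=> //; apply: qdirac_const.
  by exists 0 => //; rewrite mulr0.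
have [||||r hr e] := homog_inj_surj (phi := fun r => qdirac q (vecvar R m * r))
  _ _ _ _ (qdirac_homog q1 hp).
- by move=> r hr; apply/qdirac_homog/vecvarM_homog.
- by move=> r1 r2; rewrite mulrDr qdiracD.
- by move=> c r; rewrite vecvarMZ qdiracZ.
- by move=> r; apply: qdirac_vecvar_inj.
have xPw : vecvar_mul (@homspace R m (k.+1%:Z - 1)) (vecvar R m * r).
  by exists r; rewrite ?subzS1.
move: (vecvar R m * r) xPw e => w xPw e.
have hw := vecvar_mul_homog xPw.
exists (p - w), w; split; [split | exact: xPw | by rewrite subrK].
  exact: rpredB hp hw.
have := qdiracD (p - w) w q1; rewrite subrK -e.
move: (qdirac q (p - w)) (qdirac q w) => a b b_ab.
by apply: (addIr b); rewrite add0r.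
Qed.

End FischerDecomposition.

Theorem theorem4p3 (R : realType) (m : nat) (q : R) (k : nat)
    (hm : (1 <= m)%N) (hq0 : 0 < q) (hq1 : q != 1) :
  @direct_sum R m (@homspace R m k%:Z) (@qmonogenic R m q k)
    (vecvar_mul (@homspace R m (k%:Z - 1)))
  /\ (forall u w : {mpoly (clifford R m)[m]},
        @qmonogenic R m q k u ->
        vecvar_mul (@homspace R m (k%:Z - 1)) w ->
        fischer q k u w = 0).
Proof.
split; last by move=> u w; apply: fischer_orthogonal.
split.
- exact: real_subspace_qmonogenic.
- exact/real_subspace_vecvar_mul/real_subspace_homspace.
- move=> p; split; first exact: qdirac_decomposition.
  by case=> u [w [[hu _] /vecvar_mul_homog hw ->]]; apply: dhomogD.
- move=> p Mp xp; apply: (fischer_eq0 hq0 hq1 (vecvar_mul_homog xp)).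
  exact: fischer_orthogonal.
Qed.
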